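(* Let $\xi$ be a countable ordinal. Then there exists a countable complete discrete metric space $D_\xi$ such that $D(\mathcal F(D_\xi))>\xi$.
   Context: A metric space is discrete if each of its points is isolated. Lipschitz-free space: for a metric space $M$ with a base point $0$, $\mathrm{Lip}_0(M)$ is the Banach space of Lipschitz functions $f:M\to\mathbb R$ with $f(0)=0$, normed by the best Lipschitz constant; $\delta_M(x)\in \mathrm{Lip}_0(M)^*$ is evaluation at $x$, and $\mathcal F(M)$ is the norm-closed linear span of $\{\delta_M(x):x\in M\}$ in $\mathrm{Lip}_0(M)^*$ (independent of the base point up to linear isometry). Dentability index: all Banach spaces are real. An open slice of $X$ is a set $\{x\in X: x^*(x)>a\}$ with $x^*\in X^*$, $a\in\mathbb R$. For $C\subset X$, $\varepsilon>0$ put $d_\varepsilon(C)=C\setminus\bigcup\{S: S \text{ open slice},\ \mathrm{diam}(S\cap C)<\varepsilon\}$, $d_\varepsilon^0(C)=C$, $d_\varepsilon^{\alpha+1}(C)=d_\varepsilon(d_\varepsilon^\alpha(C))$, $d_\varepsilon^\beta(C)=\bigcap_{\alpha<\beta}d_\varepsilon^\alpha(C)$ for limit $\beta$. With $B_X$ the closed unit ball, $D(X,\varepsilon)=\inf\{\alpha: d_\varepsilon^\alpha(B_X)=\emptyset\}$ and $D(X)=\sup_{\varepsilon>0}D(X,\varepsilon)$ ($\inf\emptyset=\infty$, $\alpha<\infty$ for every ordinal $\alpha$). *)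

(* Defs.v *)
From HB Require Import structures.
From mathcomp Require Import all_boot all_order all_algebra.
From mathcomp Require Import all_classical all_reals all_analysis.

Set Implicit Arguments.
Unset Strict Implicit.
Unset Printing Implicit Defensive.

Import Order.TTheory GRing.Theory Num.Theory.
Import numFieldNormedType.Exports.

Local Open Scope classical_set_scope.
Local Open Scope ring_scope.

(* Ordinals are represented by well-ordered types; equality of ordinals is    *)
(* order isomorphism [oeq], and [olt a b] says that a is isomorphic to a       *)
(* proper initial segment of b.                                                *)
Record Ord := MkOrd {
  Ord_car :> Type;
  ord_lt : Ord_car -> Ord_car -> Prop;
  ord_lt_wf : well_founded ord_lt;
  ord_lt_trans : forall x y z, ord_lt x y -> ord_lt y z -> ord_lt x z;
  ord_lt_total : forall x y, [\/ ord_lt x y, x = y | ord_lt y x] }.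

Definition oeq (a b : Ord) : Prop := exists f : a -> b,
  (forall x y, ord_lt x y -> ord_lt (f x) (f y)) /\ range f = setT.

Definition olt (a b : Ord) : Prop := exists (z : b) (f : a -> b),
  (forall x y, ord_lt x y -> ord_lt (f x) (f y)) /\
  range f = [set y | ord_lt y z].

Definition ole (a b : Ord) : Prop := olt a b \/ oeq a b.

Section ord_comparison.
Implicit Types a b c : Ord.

Lemma ord_lt_irr a (x : a) : ~ ord_lt x x.
Proof.
by elim: (ord_lt_wf x) => {}x _ IH xx; exact: (IH x xx xx).
Qed.

Lemma ord_mono_inj a b (f : a -> b) :
  (forall x y, ord_lt x y -> ord_lt (f x) (f y)) -> injective f.
Proof.
move=> fm x y fxy; have [/fm|//|/fm] := ord_lt_total x y;
  by rewrite fxy => /ord_lt_irr.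
Qed.

Lemma ord_mono_refl a b (f : a -> b) :
  (forall x y, ord_lt x y -> ord_lt (f x) (f y)) ->
  forall x y, ord_lt (f x) (f y) -> ord_lt x y.
Proof.
move=> fm x y fxy; have [//|xy|/fm yx] := ord_lt_total x y.
  by move: fxy; rewrite xy => /ord_lt_irr.
by have /ord_lt_irr := ord_lt_trans fxy yx.
Qed.

Lemma oeq_refl a : oeq a a.
Proof.
by exists id; split=> //; apply/seteqP; split=> // x _; exists x.
Qed.

Lemma oeq_sym a b : oeq a b -> oeq b a.
Proof.
move=> [f [fm fs]].
have gP y : exists x, f x = y by have : range f y by [rewrite fs]; case=> x; exists x.
pose g y := sval (cid (gP y)).
have fg y : f (g y) = y by exact: (svalP (cid (gP y))).
exists g; split.
  by move=> x y xy; apply: (ord_mono_refl fm); rewrite !fg.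
apply/seteqP; split=> // x _; exists (f x) => //.
by apply: (ord_mono_inj fm); rewrite fg.
Qed.

Lemma oeq_trans b a c : oeq a b -> oeq b c -> oeq a c.
Proof.
move=> [f [fm fs]] [g [gm gs]]; exists (g \o f); split.
  by move=> x y /fm/gm.
by rewrite -(image_comp f g) fs.
Qed.

Lemma oeq_olt_trans b a c : oeq a b -> olt b c -> olt a c.
Proof.
move=> [f [fm fs]] [z [g [gm gs]]]; exists z, (g \o f); split.
  by move=> x y /fm/gm.
by rewrite -(image_comp f g) fs.
Qed.

Lemma olt_oeq_trans b a c : olt a b -> oeq b c -> olt a c.
Proof.
move=> [z [f [fm fs]]] [g [gm gs]]; exists (g z), (g \o f); split.
  by move=> x y /fm/gm.
rewrite -(image_comp f g) fs; apply/seteqP; split=> [_ [y yz <-]|y] /=.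
  exact: gm.
have : range g y by rewrite gs.
by move=> [x _ <-] /(ord_mono_refl gm) xz; exists x.
Qed.

Lemma olt_wf : well_founded olt.
Proof.
suff acc b (z : b) (a : Ord) (f : a -> b) :
    (forall x y, ord_lt x y -> ord_lt (f x) (f y)) ->
    range f = [set y | ord_lt y z] -> Acc olt a.
  by move=> b; constructor=> a [z [f [fm fs]]]; exact: acc fm fs.
elim: (ord_lt_wf z) a f => {}z _ IH a f fm fs.
constructor=> c [x [g [gm gs]]].
have fxz : ord_lt (f x) z by have : range f (f x) by [exists x]; rewrite fs.
apply: (IH _ fxz _ (f \o g)) => [u v /gm/fm//|].
rewrite -(image_comp g f) gs; apply/seteqP; split=> [_ [y yx <-]|y yfx] /=.
  exact: fm.
have : range f y by rewrite fs; exact: ord_lt_trans fxz.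
by move: yfx => /[swap] -[t _ <-] /(ord_mono_refl fm) tx; exists t.
Qed.

Lemma olt_trans b a c : olt a b -> olt b c -> olt a c.
Proof.
move=> [z [f [fm fs]]] [w [g [gm gs]]]; exists (g z), (g \o f); split.
  by move=> x y /fm/gm.
rewrite -(image_comp f g) fs; apply/seteqP; split=> [_ [y yz <-]|y yz] /=.
  exact: gm.
have gzw : ord_lt (g z) w by have : range g (g z) by [exists z]; rewrite gs.
have : range g y by rewrite gs; exact: ord_lt_trans gzw.
by move: yz => /[swap] -[t _ <-] /(ord_mono_refl gm) tz; exists t.
Qed.

Lemma olt_irr a : ~ olt a a.
Proof. by elim: (olt_wf a) => {}a _ IH aa; exact: (IH a aa aa). Qed.

Definition oseg a (x : a) : Ord.
Proof.
pose lt (u v : {y : a | ord_lt y x}) := ord_lt (sval u) (sval v).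
apply: (@MkOrd _ lt).
- suff acc (y : a) : forall u : {y : a | ord_lt y x}, sval u = y -> Acc lt u.
    by move=> u; exact: acc erefl.
  elim: (ord_lt_wf y) => {}y _ IH u uy; constructor=> v vu.
  by apply: IH erefl; rewrite -uy.
- by move=> u v w; exact: ord_lt_trans.
- move=> [u ux] [v vx]; have [uv|uv|vu] := ord_lt_total u v.
  + exact: Or31.
  + by apply: Or32; exact: eq_exist.
  + exact: Or33.
Defined.

Lemma olt_oseg a (x : a) : olt (oseg x) a.
Proof.
exists x, sval; split=> //; apply/seteqP; split=> [_ [[y yx] _ <-]//|y yx].
by exists (exist _ y yx).
Qed.

Lemma olt_osegP c a : olt c a -> exists x : a, oeq c (oseg x).
Proof.
move=> [x [f [fm fs]]]; exists x.
have fx t : ord_lt (f t) x by have : range f (f t) by [exists t]; rewrite fs.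
exists (fun t => exist _ (f t) (fx t)); split; first by move=> u v /fm.
apply/seteqP; split=> // -[y yx] _.
have : range f y by rewrite fs.
by move=> [t _ ty]; exists t => //; exact: eq_exist.
Qed.

Lemma oseg_lt a (x y : a) : ord_lt x y -> olt (oseg x) (oseg y).
Proof.
move=> xy; exists (exist _ x xy : oseg y).
exists (fun t : oseg x => exist _ (sval t) (ord_lt_trans (svalP t) xy) : oseg y).
split=> //; apply/seteqP; split=> [_ [[t tx] _ <-]//|[t ty] /= tx].
by exists (exist _ t tx) => //; exact: eq_exist.
Qed.

Lemma oseg_ltP a b (x y : a) (u v : b) :
  oeq (oseg x) (oseg u) -> oeq (oseg y) (oseg v) -> ord_lt x y -> ord_lt u v.
Proof.
move=> xu yv /oseg_lt xy.
have uv : olt (oseg u) (oseg v).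
  exact: (oeq_olt_trans (oeq_sym xu)) (olt_oeq_trans xy yv).
have [//|uv'|/oseg_lt vu] := ord_lt_total u v.
  by move: uv; rewrite uv' => /olt_irr.
by have /olt_irr := olt_trans uv vu.
Qed.

Lemma oseg_inj a (x y : a) : oeq (oseg x) (oseg y) -> x = y.
Proof.
move=> xy; have [/oseg_lt|//|/oseg_lt] := ord_lt_total x y.
  by move=> /olt_oeq_trans/(_ (oeq_sym xy))/olt_irr.
by move=> /olt_oeq_trans/(_ xy)/olt_irr.
Qed.

Lemma olt_total a b : [\/ olt a b, oeq a b | olt b a].
Proof.
elim: (olt_wf a) b => {}a _ IHa b; elim: (olt_wf b) => {}b _ IHb.
have [|na] := pselect (exists2 a', olt a' a & ole b a').
  move=> [a' a'a [ba'|ba']]; apply: Or33; first exact: olt_trans ba' a'a.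
  exact: oeq_olt_trans ba' a'a.
have [|nb] := pselect (exists2 b', olt b' b & ole a b').
  move=> [b' b'b [ab'|ab']]; apply: Or31; first exact: olt_trans ab' b'b.
  exact: oeq_olt_trans ab' b'b.
have ha (x : a) : exists y : b, oeq (oseg x) (oseg y).
  apply: olt_osegP; have [//|xb|bx] := IHa _ (olt_oseg x) b.
    by case: na; exists (oseg x); [exact: olt_oseg|right; exact: oeq_sym].
  by case: na; exists (oseg x); [exact: olt_oseg|left].
have hb (y : b) : exists x : a, oeq (oseg y) (oseg x).
  apply: olt_osegP; have [ay|ay|//] := IHb _ (olt_oseg y).
    by case: nb; exists (oseg y); [exact: olt_oseg|left].
  by case: nb; exists (oseg y); [exact: olt_oseg|right].
apply: Or32; pose f x := sval (cid (ha x)).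
have fP x : oeq (oseg x) (oseg (f x)) by exact: (svalP (cid (ha x))).
exists f; split=> [x y|]; first exact: oseg_ltP.
apply/seteqP; split=> // y _; have [x yx] := hb y; exists x => //.
apply: oseg_inj; apply: oeq_trans (oeq_sym (fP x)) _; exact: oeq_sym.
Qed.

End ord_comparison.

Definition ozero : Ord := @MkOrd Empty_set (fun _ _ => False)
  (fun x => match x with end) (fun x => match x with end)
  (fun x => match x with end).

Definition osucc_lt (a : Ord) (x y : option a) : Prop :=
  match x, y with
  | Some u, Some v => ord_lt u v
  | Some _, None => True
  | None, _ => False
  end.

Lemma osucc_lt_wf (a : Ord) : well_founded (@osucc_lt a).
Proof.
have accS (x : a) : Acc (@osucc_lt a) (Some x).
  by elim: (ord_lt_wf x) => {}x _ IH; constructor=> -[y /IH//|//].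
move=> [x|]; first exact: accS.
by constructor=> -[x _|[]]; exact: accS.
Qed.

Lemma osucc_lt_trans (a : Ord) (x y z : option a) :
  osucc_lt x y -> osucc_lt y z -> osucc_lt x z.
Proof. by case: x y z => [x|] [y|] [z|] //=; exact: ord_lt_trans. Qed.

Lemma osucc_lt_total (a : Ord) (x y : option a) :
  [\/ osucc_lt x y, x = y | osucc_lt y x].
Proof.
case: x y => [x|] [y|] /=.
- by have [xy|->|yx] := ord_lt_total x y; [exact: Or31|exact: Or32|exact: Or33].
- exact: Or31.
- exact: Or33.
- exact: Or32.
Qed.

Definition osucc (a : Ord) : Ord :=
  MkOrd (@osucc_lt_wf a) (@osucc_lt_trans a) (@osucc_lt_total a).

Definition olimit (a : Ord) : Prop :=
  ~ oeq a ozero /\ forall b, ~ oeq a (osucc b).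

Lemma olt_succ (a : Ord) : olt a (osucc a).
Proof.
exists None, Some; split=> //; apply/seteqP; split=> [_ [x _ <-]//|[x|]//].
Qed.

Lemma oeq_succ_olt (a b : Ord) : oeq a (osucc b) -> olt b a.
Proof. by move=> /oeq_sym; apply: olt_oeq_trans; exact: olt_succ. Qed.

Lemma osucc_neq0 (a : Ord) : ~ oeq (osucc a) ozero.
Proof. by case=> f _; case: (f None). Qed.

Lemma osucc_inj (a b : Ord) : oeq (osucc a) (osucc b) -> oeq a b.
Proof.
move=> [f [fm fs]].
have fN : f None = None.
  have : range f None by rewrite fs.
  by case=> -[x|//] _ fx; have := fm (Some x) None I; rewrite fx.
have fS x : exists y, f (Some x) = Some y.
  case E: (f (Some x)) => [y|]; first by exists y.
  by have := ord_mono_inj fm (etrans E (esym fN)).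
pose g x := sval (cid (fS x)).
have gE x : f (Some x) = Some (g x) by exact: (svalP (cid (fS x))).
exists g; split.
  by move=> x y xy; have := fm (Some x) (Some y) xy; rewrite !gE.
apply/seteqP; split=> // y _; have : range f (Some y) by rewrite fs.
by case=> -[x|] _; rewrite ?fN// gE => -[<-]; exists x.
Qed.

(* [Some a] is the ordinal a and [None] is the symbol oo lying above all      *)
(* ordinals.                                                                  *)
Definition xole (x y : option Ord) : Prop :=
  match x, y with
  | _, None => True
  | None, Some _ => False
  | Some a, Some b => ole a b
  end.

Definition xolt (x y : option Ord) : Prop :=
  match x, y with
  | None, _ => False
  | Some _, None => True
  | Some a, Some b => olt a b
  end.

Definition olb (P : set Ord) (a : Ord) : Prop := forall b, P b -> ole a b.

Definition oinf (P : set Ord) : option Ord :=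
  if pselect (exists a, P a /\ olb P a) is left h then Some (sval (cid h))
  else None.

Lemma oinf_min (P : set Ord) a : P a ->
  exists b, [/\ oinf P = Some b, P b & olb P b].
Proof.
move=> Pa; have h : exists b, P b /\ olb P b.
  elim: (olt_wf a) Pa => {}a _ IH Pa.
  have [[b Pb ba]|nP] := pselect (exists2 b, P b & olt b a); first exact: IH Pb.
  exists a; split=> // b Pb; have [ab|ab|ba] := olt_total a b.
  - by left.
  - by right.
  - by case: nP; exists b.
rewrite /oinf; case: pselect => // h'.
by exists (sval (cid h')); case: (svalP (cid h')).
Qed.

Definition xosup (A : set (option Ord)) : option Ord :=
  oinf [set b | forall x, A x -> xole x (Some b)].

Section Lip0_type.
Context {R : realType} {M : metricType R}.

(* Requiring 0 <= K keeps the set of constants bounded below when M is a point. *)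
Definition lipschitz_const (f : M -> R) (K : R) : Prop :=
  0 <= K /\ forall x y, `|f x - f y| <= K * mdist x y.

Definition lip0 (x0 : M) : {pred M -> R} :=
  mem [set f : M -> R | f x0 = 0 /\ exists K, lipschitz_const f K].

Record Lip0 (x0 : M) := MkLip0 {
  Lip0_fun :> M -> R;
  _ : Lip0_fun \in lip0 x0 }.

Variable x0 : M.

HB.instance Definition _ := [isSub for @Lip0_fun x0].
HB.instance Definition _ := [Choice of Lip0 x0 by <:].

Lemma lip0_submod_closed : submod_closed (lip0 x0).
Proof.
split.
  by rewrite inE; split => //; exists 0; split => // x y; rewrite subrr normr0 mul0r.
move=> a f g; rewrite !inE => -[f0 [K [K0 fK]]] [g0 [L [L0 gL]]]; split.
  by rewrite /= !fctE f0 g0 scaler0 addr0.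
exists (`|a| * K + L); split; first by rewrite addr_ge0// mulr_ge0.
move=> x y; rewrite !fctE opprD addrACA -scalerBr mulrDl.
rewrite (le_trans (ler_normD _ _))// lerD// normrM -mulrA.
by rewrite ler_wpM2l.
Qed.

HB.instance Definition _ := GRing.isSubmodClosed.Build _ _ (lip0 x0)
  lip0_submod_closed.
HB.instance Definition _ := [SubChoice_isSubLmodule of Lip0 x0 by <:].


Implicit Types f g : Lip0 x0.

Lemma Lip0P (f : Lip0 x0) : f x0 = 0 /\ exists K, lipschitz_const f K.
Proof. by have := valP f; rewrite inE. Qed.

Lemma Lip0D (f g : Lip0 x0) x : (f + g) x = f x + g x. Proof. by []. Qed.
Lemma Lip0Z (a : R) (f : Lip0 x0) x : (a *: f) x = a * f x. Proof. by []. Qed.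

Definition lip_norm (f : Lip0 x0) : R := inf [set K | lipschitz_const f K].

Lemma lip_norm_has_inf f : has_inf [set K | lipschitz_const f K].
Proof.
have [_ [K fK]] := Lip0P f; split; first by exists K.
by exists 0 => L [].
Qed.

Lemma lip_norm_ge0 f : 0 <= lip_norm f.
Proof.
by apply: lb_le_inf; [have [] := lip_norm_has_inf f | move=> K []].
Qed.

Lemma lip_norm_lipschitz f : lipschitz_const f (lip_norm f).
Proof.
split=> [|x y]; first exact: lip_norm_ge0.
have [fK0 _] := lip_norm_has_inf f.
have [->|xy] := eqVneq x y; first by rewrite subrr normr0 mdistxx mulr0.
rewrite -ler_pdivrMr ?mdist_gt0//; apply: lb_le_inf => // K [_ fK].
by rewrite ler_pdivrMr ?mdist_gt0.
Qed.

Lemma lip_norm_le f K : lipschitz_const f K -> lip_norm f <= K.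
Proof. by move=> fK; apply: ge_inf => //; case: (lip_norm_has_inf f). Qed.

Lemma ler_lip_normD f g : lip_norm (f + g) <= lip_norm f + lip_norm g.
Proof.
have [f0 fL] := lip_norm_lipschitz f; have [g0 gL] := lip_norm_lipschitz g.
apply: lip_norm_le; split=> [|x y]; first exact: addr_ge0.
by rewrite !Lip0D opprD addrACA mulrDl (le_trans (ler_normD _ _))// lerD.
Qed.

Lemma lip_norm_leZ a f : lip_norm (a *: f) <= `|a| * lip_norm f.
Proof.
have [f0 fL] := lip_norm_lipschitz f.
apply: lip_norm_le; split=> [|x y]; first exact: mulr_ge0.
by rewrite !Lip0Z -mulrBr normrM -mulrA ler_wpM2l.
Qed.

Lemma lip_norm0_eq0 f : lip_norm f = 0 -> f = 0.
Proof.
move=> f0; apply/val_inj/funext => x /=.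
have [_ /(_ x x0)] := lip_norm_lipschitz f.
have [-> _] := Lip0P f.
by rewrite f0 mul0r subr0 normr_le0 => /eqP.
Qed.

Lemma lip_normZ a f : lip_norm (a *: f) = `|a| * lip_norm f.
Proof.
apply/eqP; rewrite eq_le lip_norm_leZ /=.
have [->|a0] := eqVneq a 0; first by rewrite normr0 mul0r lip_norm_ge0.
rewrite -ler_pdivlMl ?normr_gt0// -normfV.
by rewrite (le_trans _ (lip_norm_leZ _ _))// scalerA mulVf// scale1r.
Qed.

HB.instance Definition _ := Lmodule_isNormed.Build R (Lip0 x0)
  ler_lip_normD lip_normZ lip_norm0_eq0.

End Lip0_type.

Section topological_dual.
Context {R : realType} (V : normedModType R).

Definition linear_continuous_form : {pred V -> R} :=
  mem [set f : V -> R | linear f /\ continuous f].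

Record tdual := MkTdual {
  tdual_fun :> V -> R;
  _ : tdual_fun \in linear_continuous_form }.

HB.instance Definition _ := [isSub for tdual_fun].
HB.instance Definition _ := [Choice of tdual by <:].

Lemma linear_continuous_submod_closed : submod_closed linear_continuous_form.
Proof.
split.
  rewrite inE; split; last by move=> x; exact: cvg_cst.
  by move=> a x y; rewrite /= scaler0 addr0.
move=> a f g; rewrite !inE => -[fl fc] [gl gc]; split.
  move=> b x y; rewrite !fctE fl gl !scalerDr !scalerA (mulrC a b).
  by rewrite addrACA.
by move=> x; apply: cvgD; [apply: cvgZr; exact: fc|exact: gc].
Qed.

HB.instance Definition _ := GRing.isSubmodClosed.Build _ _
  linear_continuous_form linear_continuous_submod_closed.
HB.instance Definition _ := [SubChoice_isSubLmodule of tdual by <:].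

Lemma tdual_linear (f : tdual) : linear f.
Proof. by have := valP f; rewrite inE => -[]. Qed.

Lemma tdual_continuous (f : tdual) : continuous f.
Proof. by have := valP f; rewrite inE => -[]. Qed.

HB.instance Definition _ (f : tdual) :=
  GRing.isLinear.Build R V R *:%R f (tdual_linear f).

Implicit Types f g : tdual.

Lemma tdualD (f g : tdual) x : (f + g) x = f x + g x. Proof. by []. Qed.
Lemma tdualZ (a : R) (f : tdual) x : (a *: f) x = a * f x. Proof. by []. Qed.

Definition op_norm (f : tdual) : R :=
  sup [set `|f x| | x in [set x | `|x| <= 1]].

Lemma op_norm_has_sup (f : tdual) :
  has_sup [set `|f x| | x in [set x | `|x| <= 1]].
Proof.
split; first by exists `|f 0|, 0 => //=; rewrite normr0.
have /linear_boundedP : bounded_near f (nbhs 0).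
  exact: continuous_linear_bounded (@tdual_continuous f 0).
move=> /pinfty_ex_gt0 [K K0 fK]; exists K => _ [x x1 <-].
by rewrite (le_trans (fK x))// ler_piMr// ltW.
Qed.

Lemma op_norm_ge0 f : 0 <= op_norm f.
Proof.
apply: le_trans (ub_le_sup (op_norm_has_sup f).2 _) => /=.
  exact: (normr_ge0 (f 0)).
by exists 0 => //=; rewrite normr0.
Qed.

Lemma op_norm_bound (f : tdual) x : `|f x| <= op_norm f * `|x|.
Proof.
have [->|x0] := eqVneq x 0; first by rewrite raddf0 !normr0 mulr0.
rewrite -ler_pdivrMr ?normr_gt0//.
apply: (ub_le_sup (op_norm_has_sup f).2); exists (`|x|^-1 *: x) => /=.
  by rewrite normrZ normfV normr_id mulVf ?normr_eq0.
by rewrite linearZ normrM normfV normr_id mulrC.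
Qed.

Lemma op_norm_le (f : tdual) K : 0 <= K ->
  (forall x, `|f x| <= K * `|x|) -> op_norm f <= K.
Proof.
move=> K0 fK; apply: ge_sup; first by have [] := op_norm_has_sup f.
by move=> _ [x x1 <-]; rewrite (le_trans (fK x))// ler_piMr.
Qed.

Lemma ler_op_normD f g : op_norm (f + g) <= op_norm f + op_norm g.
Proof.
apply: op_norm_le => [|x]; first by rewrite addr_ge0 ?op_norm_ge0.
by rewrite tdualD mulrDl (le_trans (ler_normD _ _))// lerD ?op_norm_bound.
Qed.

Lemma op_norm_leZ a f : op_norm (a *: f) <= `|a| * op_norm f.
Proof.
apply: op_norm_le => [|x]; first by rewrite mulr_ge0 ?op_norm_ge0.
by rewrite tdualZ normrM -mulrA ler_wpM2l ?op_norm_bound.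
Qed.

Lemma op_norm0_eq0 f : op_norm f = 0 -> f = 0.
Proof.
move=> f0; apply/val_inj/funext => x /=.
by have := op_norm_bound f x; rewrite f0 mul0r normr_le0 => /eqP.
Qed.

Lemma op_normZ a f : op_norm (a *: f) = `|a| * op_norm f.
Proof.
apply/eqP; rewrite eq_le op_norm_leZ /=.
have [->|a0] := eqVneq a 0; first by rewrite normr0 mul0r op_norm_ge0.
rewrite -ler_pdivlMl ?normr_gt0// -normfV.
by rewrite (le_trans _ (op_norm_leZ _ _))// scalerA mulVf// scale1r.
Qed.

HB.instance Definition _ := Lmodule_isNormed.Build R tdual
  ler_op_normD op_normZ op_norm0_eq0.

End topological_dual.

Section Lipschitz_free.
Context {R : realType} {M : metricType R} (x0 : M).

Lemma evaluation_subproof (x : M) :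
  (fun f : Lip0 x0 => f x) \in @linear_continuous_form R (Lip0 x0).
Proof.
rewrite inE; have ev_lin : linear (fun f : Lip0 x0 => f x) by [].
split => //.
pose ev : {linear Lip0 x0 -> R} :=
  HB.pack (fun f : Lip0 x0 => f x) (GRing.isLinear.Build _ _ _ _ _ ev_lin).
apply: (@bounded_linear_continuous _ _ _ ev); apply/linear_boundedP.
near=> r => f /=.
have [_ /(_ x x0)] := lip_norm_lipschitz f; have [-> _] := Lip0P f.
rewrite subr0 => /le_trans; apply; rewrite mulrC ler_wpM2r ?lip_norm_ge0//.
Unshelve. all: by end_near. Qed.

Definition delta (x : M) : tdual (Lip0 x0) := MkTdual (evaluation_subproof x).

Definition delta_span : set (tdual (Lip0 x0)) :=
  [set u | exists (n : nat) (a : 'I_n -> R) (x : 'I_n -> M),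
     u = \sum_(i < n) a i *: delta (x i)].

Definition lipfree_set : {pred tdual (Lip0 x0)} := mem (closure delta_span).

Record lipfree := MkLipfree {
  lipfree_val :> tdual (Lip0 x0);
  _ : lipfree_val \in lipfree_set }.

HB.instance Definition _ := [isSub for lipfree_val].
HB.instance Definition _ := [Choice of lipfree by <:].

Lemma delta_spanZD a u v :
  delta_span u -> delta_span v -> delta_span (a *: u + v).
Proof.
move=> [n [b [x ->]]] [m [c [y ->]]].
exists (n + m)%N.
exists (fun i => match fintype.split i with inl j => a * b j | inr j => c j end).
exists (fun i => match fintype.split i with inl j => x j | inr j => y j end).
rewrite big_split_ord/= scaler_sumr; congr (_ + _).
  apply: eq_bigr => i _; rewrite -[lshift m i]/(unsplit (inl i)) unsplitK.
  by rewrite scalerA.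
by apply: eq_bigr => i _; rewrite -[rshift n i]/(unsplit (inr i)) unsplitK.
Qed.

Lemma closure_delta_spanP (u : tdual (Lip0 x0)) :
  closure delta_span u <->
  forall e, 0 < e -> exists2 v, delta_span v & `|u - v| < e.
Proof.
split=> [cu e e0|H B].
  have [v [sv uv]] := cu _ (nbhsx_ballx u e e0).
  by exists v => //; move: uv; rewrite -ball_normE.
move=> /nbhs_ballP[e /= e0 eB]; have [v sv uv] := H _ e0.
by exists v; split=> //; apply: eB; rewrite -ball_normE.
Qed.

Lemma lipfree_submod_closed : submod_closed lipfree_set.
Proof.
split.
  rewrite inE; apply: subset_closure; exists 0%N, (fun=> 0), (fun=> x0).
  by rewrite big_ord0.
move=> a u v; rewrite !inE => /closure_delta_spanP uS /closure_delta_spanP vS.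
apply/closure_delta_spanP => e e0.
have a1 : 0 < `|a| + 1 by rewrite ltr_wpDl.
have [u' su uu'] := uS (e / 2 / (`|a| + 1)) (divr_gt0 (divr_gt0 e0 (ltr0n _ 2)) a1).
have [v' sv vv'] := vS (e / 2) (divr_gt0 e0 (ltr0n _ 2)).
exists (a *: u' + v'); first exact: delta_spanZD.
rewrite opprD addrACA -scalerBr [e]splitr (le_lt_trans (ler_normD _ _))//.
rewrite ler_ltD// normrZ; move: uu'; rewrite ltr_pdivlMr// => /ltW.
by apply: le_trans; rewrite mulrC ler_wpM2l// lerDl.
Qed.

HB.instance Definition _ := GRing.isSubmodClosed.Build _ _ lipfree_set
  lipfree_submod_closed.
HB.instance Definition _ := [SubChoice_isSubLmodule of lipfree by <:].

Definition lipfree_norm (u : lipfree) : R := `|lipfree_val u|.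

Implicit Types u v : lipfree.

Lemma ler_lipfree_normD u v :
  lipfree_norm (u + v) <= lipfree_norm u + lipfree_norm v.
Proof. exact: ler_normD. Qed.

Lemma lipfree_normZ a u : lipfree_norm (a *: u) = `|a| * lipfree_norm u.
Proof. exact: normrZ. Qed.

Lemma lipfree_norm0_eq0 u : lipfree_norm u = 0 -> u = 0.
Proof. by move=> /eqP; rewrite normr_eq0 => /eqP u0; exact/val_inj. Qed.

HB.instance Definition _ := Lmodule_isNormed.Build R lipfree
  ler_lipfree_normD lipfree_normZ lipfree_norm0_eq0.

End Lipschitz_free.

Section dentability.
Context {R : realType} {X : normedModType R}.
Implicit Types (C S : set X) (e : R).

Definition open_slice S : Prop :=
  exists (f : tdual X) (a : R), S = [set x | a < f x].

(* With this supremum, diam set0 = -oo. *)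
Definition diam (A : set X) : \bar R :=
  ereal_sup [set `|p.1 - p.2|%:E | p in A `*` A].

Definition dent_deriv e C : set X :=
  C `\` \bigcup_(S in [set S | open_slice S /\ (diam (S `&` C) < e%:E)%E]) S.

(* The recursion is over all ordinals up to isomorphism: an ordinal is zero,  *)
(* or a successor, or a limit, and exactly one of the three clauses is not    *)
(* vacuous. See dent_iter0, dent_iterS and dent_iter_limit for the resulting  *)
(* equations.                                                                 *)
Definition dent_iter_step e C (a : Ord)
    (rec : forall b, olt b a -> set X) : set X :=
  [set x | [/\ oeq a ozero -> C x,
    forall b (ab : oeq a (osucc b)),
      dent_deriv e (rec b (oeq_succ_olt ab)) x &
    olimit a -> forall b (ba : olt b a), rec b ba x]].

Definition dent_iter e C : Ord -> set X :=
  Fix olt_wf (fun=> set X) (dent_iter_step e C).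

Lemma dent_iterE e C a :
  dent_iter e C a = dent_iter_step e C (fun b (_ : olt b a) => dent_iter e C b).
Proof.
rewrite /dent_iter Fix_eq// => {}a f g fg.
by congr dent_iter_step; apply/functional_extensionality_dep => b;
  apply/functional_extensionality_dep => ba.
Qed.

Lemma dent_iter_oeq e C a b : oeq a b -> dent_iter e C a = dent_iter e C b.
Proof.
suff H c d : oeq c d -> dent_iter e C c `<=` dent_iter e C d.
  by move=> ab; apply/seteqP; split; apply: H => //; exact: oeq_sym.
move=> cd x; rewrite !dent_iterE => -[x0 xS xL]; split.
- by move=> d0; apply: x0; exact: oeq_trans cd d0.
- by move=> b' db; exact: (xS b' (oeq_trans cd db)).
- move=> [d0 dS] b' bd; apply: xL.
    split=> [/(oeq_trans (oeq_sym cd))//|b'' /(oeq_trans (oeq_sym cd))].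
    exact: dS.
  exact: olt_oeq_trans (oeq_sym cd).
Qed.

Lemma dent_iter0 e C : dent_iter e C ozero = C.
Proof.
rewrite dent_iterE; apply/seteqP; split=> [x [/(_ (oeq_refl _))//]|x Cx].
split=> [//|b /oeq_sym/osucc_neq0//|[/(_ (oeq_refl _))//]].
Qed.

Lemma dent_iterS e C a :
  dent_iter e C (osucc a) = dent_deriv e (dent_iter e C a).
Proof.
rewrite [LHS]dent_iterE; apply/seteqP; split=> [x [_ /(_ a (oeq_refl _))//]|x xS].
split=> [/osucc_neq0//|b /osucc_inj/(dent_iter_oeq e C) <-//|].
by move=> [_ /(_ a (oeq_refl _))].
Qed.

Lemma dent_iter_limit e C a : olimit a ->
  dent_iter e C a = \bigcap_(b in [set b | olt b a]) dent_iter e C b.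
Proof.
move=> la; rewrite dent_iterE; apply/seteqP; split=> [x [_ _ xL] b ba|x xL].
  exact: xL.
by split=> [/la.1//|b /la.2//|_ b ba]; exact: xL.
Qed.

End dentability.

Definition dent_index_at {R : realType} (X : normedModType R) (e : R) :
    option Ord :=
  oinf [set a | dent_iter e [set x : X | `|x| <= 1] a = set0].

Definition dent_index {R : realType} (X : normedModType R) : option Ord :=
  xosup [set dent_index_at X e | e in [set e : R | 0 < e]].

(* This is cauchy_cvg of completeType, without the base point of that structure. *)
Definition complete_space (M : uniformType) : Prop :=
  forall F : set_system M, ProperFilter F -> cauchy F -> exists l : M, F --> l.

Definition discrete_space (M : topologicalType) : Prop :=
  forall x : M, isolated [set: M] x.

(* Main.v *)
Require Import Defs.
From HB Require Import structures.
From mathcomp Require Import all_boot all_order all_algebra.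
From mathcomp Require Import all_classical all_reals all_analysis.
From mathcomp Require Import lra.

Set Implicit Arguments.
Unset Strict Implicit.
Unset Printing Implicit Defensive.

Import Order.TTheory GRing.Theory Num.Theory.
Import numFieldNormedType.Exports.

Local Open Scope classical_set_scope.
Local Open Scope ring_scope.

(** The model is the interval [0, 1], whose free space is L^1: the molecule of an
    interval is the average of the molecules of its two halves, which are at
    distance 2 from each other, so every slice through it also meets one of the
    halves, and a dyadic subdivision of depth n keeps the molecule of [0, 1] in
    the n-th derived set of the unit ball. To reach a countable ordinal, give an
    interval of rank g one subdivision for each b < g, all running in parallel
    between the same endpoints, with pieces of rank b. The endpoints would then
    be accumulation points of the space, so each subdivision of an interval of
    level k leaves at both ends a gap of length [gap k] which is never subdivided
    again; only the middle part is cut into two intervals of level k + 1, hence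
    [len k = 2 * gap k + 2 * len k.+1]. The gaps carry some mass that no longer
    moves, but they decrease so fast that the moving part has weight
    [2 ^+ k * len k >= 1 / 2] at every level, and this gives the derivation
    parameter 1 / 2 independently of the rank ([bush_dent_iter]).

    Points are indexed by finite strictly descending sequences of ordinals (with
    a natural number telling apart the points of one subdivision). Each point has
    a real position, and the distance is the maximum of the difference of the
    positions and of an ultrametric measuring how early two sequences separate.
    The ultrametric is small enough to leave intact the distances along one
    subdivision, where positions decide, and large enough to isolate every point.
    A Cauchy filter that does not stabilise would choose longer and longer
    prefixes, hence an infinite descending sequence of ordinals; so the space is
    complete ([chain_complete]). *)

(** * Dentability derivations *)

Section derivation.
Context {R : realType} {X : normedModType R}.
Implicit Types (C : set X) (e : R) (z v : X).

(** The value of a functional at [z] is the average of its values at [z + v] and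
    [z - v], so every open slice through [z] contains one of these two points. *)
Lemma dent_deriv_midpoint e C z v : e <= `|v| ->
  C z -> C (z + v) -> C (z - v) -> dent_deriv e C z.
Proof.
move=> ev Cz Czv CzNv; split=> // -[_ [[f [c ->]] small] /= fz].
suff far w : `|w| = `|v| -> C (z + w) -> ~ c < f (z + w).
  have zv : f (z + v) + f (z - v) = f z + f z.
    by rewrite -!linearD/= addrACA subrr addr0.
  have /negP := far v erefl Czv; have /negP := far (- v) (normrN v) CzNv.
  rewrite -!leNgt; lra.
move=> wv Czw fzw; move: small; apply/negP; rewrite -leNgt.
apply: (@le_trans _ _ `|w|%:E); first by rewrite lee_fin wv.
by apply: ereal_sup_ubound; exists (z + w, z) => //=; rewrite addrAC subrr add0r.
Qed.

(** The displacement [v] may depend on the stage [b], so a single point can be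
    the root of infinitely many subdivisions; this is what makes limit stages
    harmless. *)
Lemma dent_iter_midpoint e C z a : C z ->
  (forall b, olt b a -> exists2 v, e <= `|v| &
     dent_iter e C b (z + v) /\ dent_iter e C b (z - v)) ->
  dent_iter e C a z.
Proof.
move=> Cz; elim: (olt_wf a) => {}a _ IH split_z.
have deriv b : olt b a -> dent_deriv e (dent_iter e C b) z.
  move=> ba; have [v ev [zv zNv]] := split_z b ba.
  apply: (dent_deriv_midpoint ev) => //; apply: IH => // c cb.
  by apply: split_z; exact: olt_trans ba.
rewrite dent_iterE; split=> // [b /oeq_succ_olt/deriv //|_ b /deriv[]//].
Qed.

(** Nonemptiness is required at all stages up to [a]: the index is a least stage
    with empty derived set, and this rules out every candidate below or equal to
    [a]. *)
Lemma olt_dent_index e a :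
  0 < e -> (forall b, ole b a -> dent_iter e [set x : X | `|x| <= 1] b !=set0) ->
  xolt (Some a) (dent_index X).
Proof.
move=> e0 ne; rewrite /dent_index /xosup /oinf.
case: pselect => //= h; case: (cid h) => /= b [ub _].
have := ub _ (ex_intro2 _ _ e e0 erefl).
rewrite /dent_index_at /oinf; case: pselect => //= h'.
case: (cid h') => /= c [c0 _] cb.
have ac : olt a c.
  have [//|ac|ca] := olt_total a c.
    by have [x] := ne c (or_intror (oeq_sym ac)); rewrite c0.
  by have [x] := ne c (or_introl ca); rewrite c0.
by case: cb => [|cb]; [exact: olt_trans ac|exact: olt_oeq_trans ac cb].
Qed.

End derivation.

(** * Molecules in Lipschitz-free spaces *)

Section molecules.
Context {R : realType} {M : metricType R} (x0 : M).

Lemma free_delta_subproof (x : M) :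
  @delta R M x0 x \in @lipfree_set R M x0.
Proof.
rewrite inE; apply: subset_closure; exists 1%N, (fun=> 1), (fun=> x).
by rewrite big_ord1 scale1r.
Qed.

Definition free_delta (x : M) : lipfree x0 := MkLipfree (free_delta_subproof x).

Lemma norm_free_deltaB x y : `|free_delta x - free_delta y| <= mdist x y.
Proof.
apply: op_norm_le => [|f]; first exact: mdist_ge0.
rewrite mulrC; exact: (lip_norm_lipschitz f).2.
Qed.

Lemma dist_to_subproof (h : M) :
  (fun z => mdist z h - mdist x0 h) \in @lip0 R M x0.
Proof.
rewrite inE/= subrr; split=> //; exists 1; split=> // x y /=.
have := metric_triangle x y h; have := metric_triangle y x h.
by rewrite (metric_sym y x) ler_norml => ? ?; apply/andP; split; lra.
Qed.

(** The distance to [h], normalised to vanish at the base point: the test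
    function that separates the two halves of an interval with midpoint [h]. *)
Definition dist_to (h : M) : Lip0 x0 := MkLip0 (dist_to_subproof h).

Lemma norm_dist_to h : `|dist_to h| <= 1.
Proof.
apply: lip_norm_le; split=> // x y /=.
have := metric_triangle x y h; have := metric_triangle y x h.
by rewrite (metric_sym y x) ler_norml => ? ?; apply/andP; split; lra.
Qed.

(** If [h] is a metric midpoint of [x] and [y], this says that the molecules of
    the two halves are at the maximal distance 2. *)
Lemma norm_second_difference_ge x h y :
  mdist x h + mdist h y <=
  `|(free_delta h - free_delta x) - (free_delta y - free_delta h)|.
Proof.
set u := (X in _ <= `|X|).
have := op_norm_bound (lipfree_val u) (dist_to h).
have -> : lipfree_val u (dist_to h) = - (mdist x h + mdist h y).
  have -> : lipfree_val u (dist_to h) =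
    (dist_to h h - dist_to h x) - (dist_to h y - dist_to h h) by [].
  rewrite /= mdistxx (metric_sym y h); lra.
rewrite normrN => /(le_trans (ler_norm _))/le_trans; apply.
rewrite -[leRHS]/(op_norm (lipfree_val u)).
by rewrite ler_piMr ?op_norm_ge0 ?norm_dist_to.
Qed.

End molecules.

(** * The metric space of decreasing chains *)

Section lengths.
Context {R : realType}.

(** The length of the intervals of level [k], and the length that a subdivision
    of such an interval leaves untouched at each end. The dyadic part of [len]
    keeps [2 ^+ k * len k] above 1 / 2; the other part pays for all the gaps of the
    levels [k] and beyond. It is normalised by [2 * len 1 = 1]. *)
Definition len (k : nat) : R := 2^-1 ^+ k.+1 + 4^-1 ^+ k.
Definition gap (k : nat) : R := 4^-1 ^+ k.+1.

Lemma gap_gt0 k : 0 < gap k. Proof. by rewrite exprn_gt0. Qed.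

Lemma lenE k : len k = 2 * gap k + 2 * len k.+1.
Proof. by rewrite /len /gap !exprS; lra. Qed.

Lemma gap_le_len k : gap k <= len k.
Proof.
have := gap_gt0 k; have : 0 < (2^-1 : R) ^+ k.+1 by rewrite exprn_gt0.
by rewrite /len /gap !exprS; lra.
Qed.

Lemma gap_le i j : (i <= j)%N -> gap j <= gap i.
Proof. by move=> ij; rewrite /gap ler_wiXn2l//; lra. Qed.

Lemma expr2_len k : 2 ^+ k * len k = 2^-1 + 2^-1 ^+ k.
Proof.
have e : 2 ^+ k * 2^-1 ^+ k = 1 :> R by rewrite -exprMn divff ?expr1n.
have -> : len k = 2^-1 * 2^-1 ^+ k + 2^-1 ^+ k * 2^-1 ^+ k.
  by rewrite /len exprS -exprMn; congr (_ + _ ^+ _); lra.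
by rewrite mulrDr mulrCA e mulrA e; lra.
Qed.

End lengths.

Section lcp.
Context {T : eqType}.
Implicit Types x y z u : seq T.

(** The length of the longest common prefix. *)
Fixpoint lcp x y : nat :=
  match x, y with
  | a :: x', b :: y' => if a == b then (lcp x' y').+1 else 0%N
  | _, _ => 0%N
  end.

Lemma lcpC x y : lcp x y = lcp y x.
Proof.
by elim: x y => [|a x IH] [|b y] //=; rewrite eq_sym IH.
Qed.

Lemma lcp_size x y : (lcp x y <= size x)%N.
Proof. by elim: x y => [|a x IH] [|b y] //=; case: ifP => // _; exact: IH. Qed.

Lemma lcp_cat u x y : lcp (u ++ x) (u ++ y) = (size u + lcp x y)%N.
Proof. by elim: u => //= a u ->; rewrite eqxx. Qed.

Lemma lcp_ultra x y z : (minn (lcp x y) (lcp y z) <= lcp x z)%N.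
Proof.
elim: x y z => [|a x IH] [|b y] [|c z] //=; rewrite ?min0n ?minn0//.
case: eqP => [->|_]; last by rewrite min0n.
by case: eqP => _; rewrite ?minn0// minnSS ltnS.
Qed.

End lcp.

Definition descends (a : Ord) (c d : {classic a} * nat) : bool :=
  `[< ord_lt (d.1 : a) (c.1 : a) >].

(** The field [R] is a parameter of the type so that a metric with values in [R]
    can be attached to it. *)
Definition chain (R : realType) (a : Ord) : Type :=
  {s : seq ({classic a} * nat) | sorted (@descends a) s}.

HB.instance Definition _ R a := Choice.on (chain R a).

Section chain_metric.
Context {R : realType} {a : Ord}.
Local Notation label := ({classic a} * nat)%type.
Implicit Types (x y z : chain R a) (s : seq label).

(** A chain ending with [(b, j)] at depth [k] is the [j]-th point of a subdivision
    whose first point lies [gap k] to the right of the point given by the rest of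
    the chain; consecutive points of the subdivision are [len k.+1] apart. *)
Fixpoint pos (k : nat) s : R :=
  if s is c :: s' then gap k + c.2%:R * len k.+1 + pos k.+1 s' else 0.

Lemma pos_cat k s s' : pos k (s ++ s') = pos k s + pos (k + size s) s'.
Proof.
elim: s k => [|c s IH] k /=; first by rewrite addn0 add0r.
by rewrite IH addSnnS addrA.
Qed.

(** The level is shifted by one so that the last point of a subdivision, whose
    chain leaves that of the right endpoint one step before its end, is still at
    distance exactly [gap k] from that endpoint ([mdist_bead_last]). *)
Definition branch_dist s s' : R := if s == s' then 0 else gap (lcp s s').+1.

Lemma branch_dist_ge0 s s' : 0 <= branch_dist s s'.
Proof. by rewrite /branch_dist; case: ifP => // _; exact/ltW/gap_gt0. Qed.

Lemma branch_dist_ultra s1 s2 s3 :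
  branch_dist s1 s3 <= branch_dist s1 s2 + branch_dist s2 s3.
Proof.
have h := branch_dist_ge0; have h12 := h s1 s2; have h23 := h s2 s3.
have [->|n12] := eqVneq s1 s2; first by rewrite lerDr.
have [<-|n23] := eqVneq s2 s3; first by rewrite lerDl.
rewrite [leLHS]/branch_dist; case: ifP => _; first exact: addr_ge0.
have : gap (lcp s1 s3).+1 <= gap (minn (lcp s1 s2) (lcp s2 s3)).+1 :> R.
  by apply: gap_le; rewrite ltnS lcp_ultra.
move/le_trans; apply.
rewrite /branch_dist (negPf n12) (negPf n23).
have [_|_] := leqP (lcp s1 s2) (lcp s2 s3).
  by rewrite lerDl ltW ?gap_gt0.
by rewrite lerDr ltW ?gap_gt0.
Qed.

Definition chain_dist x y : R :=
  Num.max `|pos 0 (val x) - pos 0 (val y)| (branch_dist (val x) (val y)).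

Lemma chain_distxx x : chain_dist x x = 0.
Proof. by rewrite /chain_dist subrr normr0 /branch_dist eqxx maxxx. Qed.

Lemma chain_dist_ge_gap x y : x != y ->
  gap (lcp (val x) (val y)).+1 <= chain_dist x y.
Proof.
by move=> xy; rewrite /chain_dist /branch_dist -val_eqE in xy *;
  rewrite (negPf xy) le_max lexx orbT.
Qed.

Lemma chain_dist_positivity x y : chain_dist x y = 0 -> x = y.
Proof.
move=> xy0; apply/eqP/negPn/negP => /chain_dist_ge_gap.
by rewrite xy0 leNgt gap_gt0.
Qed.

Lemma chain_dist_sym x y : chain_dist x y = chain_dist y x.
Proof. by rewrite /chain_dist distrC /branch_dist eq_sym lcpC. Qed.

Lemma chain_dist_triangle y x z :
  chain_dist x z <= chain_dist x y + chain_dist y z.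
Proof.
rewrite {1}/chain_dist ge_max; apply/andP; split.
  apply: (le_trans (ler_distD (pos 0 (val y)) _ _)).
  by apply: lerD; rewrite le_max lexx.
apply: (le_trans (branch_dist_ultra _ (val y) _)).
by apply: lerD; rewrite le_max lexx orbT.
Qed.

HB.instance Definition _ := isMetric.Build R (chain R a)
  chain_distxx chain_dist_positivity chain_dist_sym chain_dist_triangle.

Lemma mdist_chainE x y : mdist x y = chain_dist x y. Proof. by []. Qed.

Lemma chain_isolated : discrete_space (chain R a).
Proof.
move=> x; split; first by rewrite inE.
exists (ball x (gap (size (val x)).+1)).
  exact/nbhsx_ballx/gap_gt0.
apply/seteqP; split=> [y [+ _]|_ ->]; last first.
  by split=> //; exact/ballxx/gap_gt0.
rewrite ballEmdist/= mdist_chainE => xy; apply/eqP; rewrite eq_sym.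
apply/negPn/negP => /chain_dist_ge_gap.
rewrite leNgt => /negP; apply; apply: (lt_le_trans xy).
by apply: gap_le; rewrite ltnS lcp_size.
Qed.

Lemma chain_countable : countable [set: a] -> countable [set: chain R a].
Proof.
move=> /countable_injP[f finj].
apply/countable_injP.
exists (fun x => pickle [seq (f c.1, c.2) | c <- val x]) => x y _ _.
move=> /(pcan_inj pickleK)/inj_map xy; apply/val_inj/xy.
by move=> [c i] [d j] /= [/finj cd ->]; rewrite cd ?inE.
Qed.

Lemma sorted_rcons2 s c d : sorted (@descends a) (rcons (rcons s c) d) =
  sorted (@descends a) (rcons s c) && descends c d.
Proof.
by case: s => [|b s] /=; rewrite ?andbT// rcons_path last_rcons.
Qed.

(** At scale [gap (size s).+1], a chain extending [s] can only be close to itself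
    or to a chain that shares with it at least one more step after [s]. *)
Lemma cauchy_chain_step (F : set_system (chain R a)) s :
  ProperFilter F -> cauchy F -> F [set x | prefix s (val x)] ->
  (exists l : chain R a, F --> l) \/
  exists c, F [set x | prefix (rcons s c) (val x)].
Proof.
move=> PF /cauchyP cF Fs.
have g0 : 0 < gap (size s).+1 / 2 :> R by rewrite divr_gt0 ?gap_gt0.
have [z Fz] := cF _ g0.
have FB : F (ball z (gap (size s).+1 / 2) `&` [set x | prefix s (val x)]).
  exact: filterI.
have [x [zx sx]] := filter_ex FB.
have close y : ball z (gap (size s).+1 / 2) y -> x != y ->
    (size s < lcp (val x) (val y))%N.
  move=> zy xy; have xy_lt := ball_splitr zx zy.
  rewrite ltnNge; apply/negP => sxy; move: xy_lt; rewrite ballEmdist/=.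
  rewrite mdist_chainE => /(le_lt_trans (chain_dist_ge_gap xy)).
  by apply/negP; rewrite -leNgt gap_le.
have [u xE] := prefixP sx; case: u => [|c u] in xE.
  left; exists x; apply/fcvg_ballP => e e0; apply: filterS FB => y [/close xy _].
  suff -> : y = x by exact: ballxx.
  apply/eqP; rewrite eq_sym; apply/negPn/negP => /xy.
  by rewrite ltnNge (leq_trans (lcp_size _ _))// xE cats0.
right; exists c; apply: filterS FB => y [/close xy /prefixP[v yE]].
suff : prefix (rcons s c) (val y) by [].
have [<-|/xy] := eqVneq x y; first by rewrite xE -cat_rcons prefix_prefix.
rewrite xE yE lcp_cat -addn1 leq_add2l; case: v {yE} => //= d v.
by case: eqP => // -> _; rewrite -cat_rcons prefix_prefix.
Qed.

(** Well-founded induction on the last ordinal of a prefix shared by the filter: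
    extending the prefix makes that ordinal decrease. *)
Lemma chain_complete : complete_space (chain R a).
Proof.
move=> F PF cF.
suff limF (g : a) i s : F [set x | prefix (rcons s (g, i)) (val x)] ->
    exists l : chain R a, F --> l.
  have FT : F [set x | prefix [::] (val x)].
    by apply: filterS filterT => x _ /=; rewrite prefix0s.
  by have [//|[[g i] /(limF g i)]] := cauchy_chain_step PF cF FT.
elim: (ord_lt_wf g) i s => {}g _ IH i s.
move=> /(cauchy_chain_step PF cF)[//|[[b j] Fb]].
suff bg : ord_lt (b : a) g by exact: IH bg _ _ Fb.
have [x /prefix_sorted] := filter_ex Fb.
by move/(_ _ (valP x)); rewrite sorted_rcons2 => /andP[_ /asboolP].
Qed.

(** As soon as the difference of the positions exceeds the bound on the
    ultrametric given by a common prefix [w], positions alone decide. *)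
Lemma mdist_chain_between x y w s s' :
  val x = w ++ s -> val y = w ++ s' ->
  gap (size w).+1 <= pos 0 (val y) - pos 0 (val x) ->
  mdist x y = pos 0 (val y) - pos 0 (val x).
Proof.
move=> xE yE gap_le_xy.
rewrite mdist_chainE /chain_dist distrC ger0_norm; last first.
  by apply: le_trans gap_le_xy; exact/ltW/gap_gt0.
apply: max_l; apply: le_trans gap_le_xy.
rewrite /branch_dist; case: eqP => [_|_]; first exact/ltW/gap_gt0.
by rewrite gap_le// ltnS xE yE lcp_cat leq_addr.
Qed.

(** The points with fixed [s] and [g] are the beads of one subdivision; two
    consecutive ones bound an interval of level [(size s).+1] and rank [g].
    Well-formedness is asked for all indices at once to put the whole subdivision
    at hand. *)
Definition bead s (g : a) (h : forall i, sorted (@descends a) (rcons s (g, i)))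
  (i : nat) : chain R a := exist _ (rcons s (g, i)) (h i).

Lemma pos_bead s g h i :
  pos 0 (val (@bead s g h i)) =
  pos 0 s + (gap (size s) + i%:R * len (size s).+1).
Proof. by rewrite /= -cats1 pos_cat/= add0n addr0. Qed.

Lemma mdist_beadS s g h i :
  mdist (@bead s g h i) (bead h i.+1) = len (size s).+1.
Proof.
have posE : pos 0 (val (bead h i.+1)) - pos 0 (val (bead h i)) = len (size s).+1.
  by rewrite !pos_bead -natr1; lra.
by rewrite (@mdist_chain_between _ _ s [:: (g, i)] [:: (g, i.+1)]) ?posE//=;
  rewrite ?cats1// gap_le_len.
Qed.

Lemma sorted_child s g i b :
  (forall i, sorted (@descends a) (rcons s (g, i))) -> ord_lt b g ->
  forall j, sorted (@descends a) (rcons (rcons s (g, i)) (b, j)).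
Proof. by move=> h bg j; rewrite sorted_rcons2 h; apply/asboolP. Qed.

Lemma mdist_bead_first s g h i b h' :
  mdist (@bead s g h i) (@bead (rcons s (g, i)) b h' 0) = gap (size s).+1.
Proof.
have posE : pos 0 (val (bead h' 0)) - pos 0 (val (bead h i)) = gap (size s).+1.
  by rewrite [in X in X - _]pos_bead size_rcons/=; lra.
rewrite (@mdist_chain_between _ _ (rcons s (g, i)) [::] [:: (b, 0%N)]) ?posE//=.
- by rewrite cats0.
- by rewrite cats1.
- by rewrite size_rcons gap_le.
Qed.

Lemma mdist_bead_last s g h i b h' :
  mdist (@bead (rcons s (g, i)) b h' 2) (@bead s g h i.+1) = gap (size s).+1.
Proof.
have posE : pos 0 (val (bead h i.+1)) - pos 0 (val (bead h' 2)) = gap (size s).+1.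
  rewrite (pos_bead h') -[rcons s _]/(val (bead h i)) !pos_bead /= size_rcons.
  by have := @lenE R (size s).+1; rewrite -natr1; lra.
by rewrite (@mdist_chain_between _ _ s [:: (g, i); (b, 2%N)] [:: (g, i.+1)]) ?posE//=;
  rewrite ?cats1// -cats1 -cats1 -catA.
Qed.

End chain_metric.

(** * A bush of points in the unit ball of the free space *)

(** The identities behind one subdivision: [x] and [y] are the ends of an interval
    and [p], [q], [r] the beads of a subdivision of it, [A] is the part that no
    longer moves. The two gaps [p - x] and [y - r] are absorbed into [A]; what is
    left is carried by one of the halves, with twice the density. *)
Section segment_splitting.
Context {R : realType} {V : normedModType R}.
Implicit Types (A x p q r y : V) (t : R).

Lemma split_segment_left t A x p q r y :
  A + t *: (y - x) + t *: ((q - p) - (r - q)) =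
  A + t *: ((p - x) + (y - r)) + (2 * t) *: (q - p).
Proof.
have -> : (2 * t) *: (q - p) = t *: ((q - p) + (q - p)).
  by rewrite mulrC -scalerA scaler_nat mulr2n.
rewrite -[LHS]addrA -[RHS]addrA -!scalerDr; congr (_ + t *: _).
rewrite (addrC (p - x)) -[in RHS](addrA (y - r)) (addrA (p - x)).
by rewrite (addrC (p - x)) subrKA opprB !addrA [RHS](ACl (1*4*3*6*5*2))/=.
Qed.

Lemma split_segment_right t A x p q r y :
  A + t *: (y - x) - t *: ((q - p) - (r - q)) =
  A + t *: ((p - x) + (y - r)) + (2 * t) *: (r - q).
Proof.
have -> : (2 * t) *: (r - q) = t *: ((r - q) + (r - q)).
  by rewrite mulrC -scalerA scaler_nat mulr2n.
rewrite -[LHS]addrA -[RHS]addrA -scalerBr -!scalerDr; congr (_ + t *: _).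
rewrite opprB -(addrA (p - x)) (addrA (y - r)) subrKA opprB !addrA.
by rewrite [RHS](ACl (3*2*5*6*1*4))/=.
Qed.

(** The mass gained by the frozen part is covered by what the moving part loses,
    so that the total stays at most 1. *)
Lemma norm_absorb_gaps t A x p r y (l g l' : R) : 0 <= t ->
  `|A| <= 1 - t * l -> l = 2 * g + 2 * l' -> `|p - x| <= g -> `|y - r| <= g ->
  `|A + t *: ((p - x) + (y - r))| <= 1 - 2 * t * l'.
Proof.
move=> t0 normA lE px yr; rewrite lE in normA.
apply: (le_trans (ler_normD _ _)); rewrite normrZ ger0_norm//.
have : `|(p - x) + (y - r)| <= 2 * g.
  by apply: (le_trans (ler_normD _ _)); lra.
by move=> /(ler_wpM2l t0); lra.
Qed.

End segment_splitting.

Section bush.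
Context {R : realType} {a : Ord}.
Variable x0 : chain R a.
Local Notation fd := (@free_delta R (chain R a) x0).

(** The moving part of the point is the molecule of an interval of rank [g],
    weighted so that its density is [2 ^+ k] at level [k]. For each [b < g] the
    subdivision of rank [b] exhibits the point as the average of two points of the
    same form, each carried by an interval of rank [b], and their distance to the
    average is [2 ^+ k.+1 * len k.+1 >= 1 / 2]. *)
Lemma bush_dent_iter (g : a) s i
    (h : forall i, sorted (@descends a) (rcons s (g, i))) (A : lipfree x0) :
  `|A| <= 1 - 2 ^+ (size s).+1 * len (size s).+1 ->
  dent_iter 2^-1 [set x : lipfree x0 | `|x| <= 1] (oseg g)
    (A + 2 ^+ (size s).+1 *: (fd (bead h i.+1) - fd (bead h i))).
Proof.
elim: (ord_lt_wf g) s i h A => {}g _ IH s i h A.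
set k := (size s).+1 => normA; set x := bead h i; set y := bead h i.+1.
have pow0 : 0 < 2 ^+ k :> R by rewrite exprn_gt0.
apply: dent_iter_midpoint => [/=|b bg].
  apply: (le_trans (ler_normD _ _)); rewrite normrZ gtr0_norm//.
  have := norm_free_deltaB x0 y x; rewrite (metric_sym y) mdist_beadS.
  rewrite -(ler_pM2l pow0); rewrite -/k; lra.
have [g' bg'] : exists g' : a, oeq b (oseg g').
  exact: olt_osegP (olt_trans bg (olt_oseg g)).
have {}bg : ord_lt g' g.
  have [//|eg|gg] := ord_lt_total g' g.
    by have := oeq_olt_trans (oeq_sym bg') bg; rewrite eg => /olt_irr.
  have := olt_trans bg (oseg_lt gg).
  by move/(oeq_olt_trans (oeq_sym bg'))/olt_irr.
rewrite (dent_iter_oeq _ _ bg') {b bg'}.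
have h' := sorted_child i h bg.
pose p : chain R a := bead h' 0; pose q : chain R a := bead h' 1.
pose r : chain R a := bead h' 2.
have px : `|fd p - fd x| <= gap k.
  by rewrite (le_trans (norm_free_deltaB _ _ _))// metric_sym mdist_bead_first.
have yr : `|fd y - fd r| <= gap k.
  by rewrite (le_trans (norm_free_deltaB _ _ _))// metric_sym mdist_bead_last.
have := norm_absorb_gaps (ltW pow0) normA (lenE k) px yr.
have {IH} := IH g' bg (rcons s (g, i)) _ h'.
rewrite size_rcons -/k (exprS 2 k) => IHk normA'.
exists (2 ^+ k *: ((fd q - fd p) - (fd r - fd q))); last first.
  split.
    rewrite split_segment_left; exact: IHk.
  rewrite split_segment_right; exact: IHk.
(* The distance between the average and either half. *)
rewrite normrZ gtr0_norm//.
have := norm_second_difference_ge x0 p q r.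
rewrite !mdist_beadS size_rcons -/k -(ler_pM2l pow0).
move=> /(le_trans _); apply.
have := @expr2_len R k.+1; have : 0 < 2^-1 ^+ k.+1 :> R by rewrite exprn_gt0.
by move: (len k.+1) => l; rewrite (exprS 2 k); lra.
Qed.

End bush.

Theorem theorem4p1 (R : realType) (xi : Ord) :
  countable [set: xi] ->
  exists (M : metricType R) (x0 : M),
    [/\ countable [set: M], complete_space M, discrete_space M &
        xolt (Some xi) (dent_index (lipfree x0))].
Proof.
move=> xi_countable.
(* With labels in the successor of [xi], intervals of every rank up to and
   including [xi] start at the root. *)
exists (chain R (osucc xi)), (exist _ [::] isT : chain R (osucc xi)).
split; [|exact: chain_complete|exact: chain_isolated|].
  apply: chain_countable; move: xi_countable => /countable_injP[f finj].
  apply/countable_injP; exists (fun o => if o is Some x then (f x).+1 else 0%N).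
  by move=> [x|] [y|] //= _ _ [/finj ->]; rewrite ?inE.
apply: (@olt_dent_index _ _ 2^-1) => // b bxi.
have [g bg] : exists g : osucc xi, oeq b (oseg g).
  apply: olt_osegP; case: bxi => [bxi|bxi].
    exact: olt_trans bxi (olt_succ xi).
  exact: oeq_olt_trans bxi (olt_succ xi).
have h i : sorted (@descends (osucc xi)) (rcons [::] (g, i)) by [].
(* Density 2 on an interval of length [len 1 = 1 / 2]: nothing is frozen yet. *)
rewrite (dent_iter_oeq _ _ bg); eexists.
apply: (@bush_dent_iter _ _ _ g [::] 0 h 0).
by rewrite normr0 expr2_len/=; lra.
Qed.
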